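(* Let $\mathcal{S}=\{\mathbf{p}_{i_1},\dots,\mathbf{p}_{i_s}\}\subset\mathbb{R}^n$, $s\ge3$, be affinely independent points with associated non-negative radii ordered so that $r_{i_1}\ge\cdots\ge r_{i_s}$ and $r_{i_1}>r_{i_s}$, such that for each pair of points in $\mathcal{S}$ the absolute difference of the radii is strictly less than the distance between the points. Assume $B_{\mathcal{S}}=\bigcap_{1\le j<k\le s}B_{i_j,i_k}$ is nonempty. Then there exist $s-2$ hyperplanes $H_2,\dots,H_{s-1}$ of $\mathbb{R}^n$ such that $B_{i_1,i_s}\cap B_{i_1,i_j}=B_{i_1,i_s}\cap H_j$ for each $j=2,\dots,s-1$, and hence $$B_{\mathcal{S}}=\bigcap_{j=2}^{s}B_{i_1,i_j}=B_{i_1,i_s}\cap\bigcap_{j=2}^{s-1}H_j .$$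
   Context: Norms are Euclidean. The bisector of the balls with centers $\mathbf{p}_j,\mathbf{p}_k$ and radii $r_j,r_k$ is $B_{j,k}=\{\mathbf{x}\in\mathbb{R}^n:\|\mathbf{p}_j-\mathbf{x}\|+r_j=\|\mathbf{p}_k-\mathbf{x}\|+r_k\}$. When $r_j>r_k$ and $r_j-r_k<\|\mathbf{p}_j-\mathbf{p}_k\|$ it is one sheet of a hyperboloid with focal points $\mathbf{p}_j,\mathbf{p}_k$; when $r_j=r_k$ it is a hyperplane. *)

(* Defs.v *)
From mathcomp Require Import all_boot all_order all_algebra.
From mathcomp Require Import classical_sets reals.

Set Implicit Arguments.
Unset Strict Implicit.
Unset Printing Implicit Defensive.

Import Order.TTheory GRing.Theory Num.Theory.

Local Open Scope classical_set_scope.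
Local Open Scope ring_scope.

(* Defined here because the library's norm on 'rV[R]_n is the sup norm. *)
Definition enorm (R : realType) (n : nat) (x : 'rV[R]_n) : R :=
  Num.sqrt (\sum_i x 0 i ^+ 2).

Definition affine_indep (R : realType) (n s : nat) (p : 'I_s -> 'rV[R]_n) :=
  forall c : 'I_s -> R,
    \sum_i c i = 0 -> \sum_i c i *: p i = 0 -> forall i, c i = 0.

Definition hyperplane (R : realType) (n : nat) (H : set 'rV[R]_n) :=
  exists (a : 'rV[R]_n) (b : R),
    a != 0 /\ H = [set x | \sum_i a 0 i * x 0 i = b].

Definition bisector (R : realType) (n s : nat) (p : 'I_s -> 'rV[R]_n)
    (r : 'I_s -> R) (j k : 'I_s) : set 'rV[R]_n :=
  [set x | enorm (p j - x) + r j = enorm (p k - x) + r k].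

Definition all_bisectors (R : realType) (n s : nat) (p : 'I_s -> 'rV[R]_n)
    (r : 'I_s -> R) : set 'rV[R]_n :=
  \bigcap_(jk in [set jk : 'I_s * 'I_s | (jk.1 < jk.2)%N])
    bisector p r jk.1 jk.2.

(* Main.v *)
Require Import Defs.
From mathcomp Require Import all_boot all_order all_algebra.
From mathcomp Require Import ring lra.
From mathcomp Require Import classical_sets reals.

Set Implicit Arguments.
Unset Strict Implicit.
Unset Printing Implicit Defensive.

Import Order.TTheory GRing.Theory Num.Theory.

Local Open Scope classical_set_scope.
Local Open Scope ring_scope.

(** With $D_j = r_1 - r_j \ge 0$ and $t = \|x - p_1\|$, squaring the equation of
    $B_{1,j}$ in the form $\|p_j - x\| = t + D_j$ cancels $t^2$ and leaves
    $2 (p_j - p_1) \cdot (x - p_1) + 2 D_j t = \|p_j - p_1\|^2 - D_j^2$, which is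
    linear in $x$ and $t$; nothing is lost because $t + D_j \ge 0$.  Since
    $D_s \ne 0$, eliminating $t$ between the equations for $j$ and $s$ gives a
    hyperplane with normal $D_s (p_j - p_1) - D_j (p_s - p_1)$.  By affine
    independence these normals are pairwise non-proportional. *)

Section DotProduct.
Variables (R : realType) (n : nat).
Implicit Types (u v w x : 'rV[R]_n) (a b : R).

Definition dot u v : R := \sum_i u 0 i * v 0 i.

Lemma dotC u v : dot u v = dot v u.
Proof. by apply: eq_bigr => i _; rewrite mulrC. Qed.

Lemma dotDl u v w : dot (u + v) w = dot u w + dot v w.
Proof. by rewrite /dot -big_split; apply: eq_bigr => i _; rewrite mxE mulrDl. Qed.

Lemma dotZl a u v : dot (a *: u) v = a * dot u v.
Proof. by rewrite /dot mulr_sumr; apply: eq_bigr => i _; rewrite mxE mulrA. Qed.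

Lemma dotBl u v w : dot (u - v) w = dot u w - dot v w.
Proof. by rewrite dotDl -scaleN1r dotZl mulN1r. Qed.

Lemma dotDr u v w : dot u (v + w) = dot u v + dot u w.
Proof. by rewrite dotC dotDl !(dotC _ u). Qed.

Lemma dotZr a u v : dot u (a *: v) = a * dot u v.
Proof. by rewrite dotC dotZl dotC. Qed.

Lemma dotBr u v w : dot u (v - w) = dot u v - dot u w.
Proof. by rewrite dotC dotBl !(dotC _ u). Qed.

Lemma dotxx_eq0 u : (dot u u == 0) = (u == 0).
Proof.
apply/eqP/eqP => [|->]; last by rewrite -(scale0r 0) dotZl mul0r.
move=> /eqP; rewrite psumr_eq0 => [/allP u0|i _]; last exact: sqr_ge0.
apply/rowP => i; rewrite mxE; apply/eqP.
by have := u0 i (mem_index_enum i); rewrite mulf_eq0 orbb.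
Qed.

Lemma enorm_ge0 u : 0 <= enorm u.
Proof. exact: sqrtr_ge0. Qed.

Lemma sqr_enorm u : enorm u ^+ 2 = dot u u.
Proof. by rewrite sqr_sqrtr //; apply: sumr_ge0 => i _; apply: sqr_ge0. Qed.

Lemma enormB u v : enorm (u - v) = enorm (v - u).
Proof.
by congr Num.sqrt; apply: eq_bigr => i _; rewrite !mxE -sqrrN opprB.
Qed.

(** The component [w] of [u] orthogonal to [v] is a direction of the common hyperplane. Moving from
    [x] along [w] thus keeps [dot u], so [w] is orthogonal to [u] too, hence to itself. *)
Lemma hyperplane_normal_collinear u v a b :
    v != 0 -> [set x | dot u x = a] !=set0 ->
    [set x | dot u x = a] = [set x | dot v x = b] ->
  exists c, u = c *: v.
Proof.
move=> v0 [x ux] uv; have vv0 : dot v v != 0 by rewrite dotxx_eq0.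
have vx : dot v x = b by have : [set x | dot u x = a] x by []; rewrite uv.
exists (dot u v / dot v v); apply/eqP; rewrite -subr_eq0.
set w := u - _; have vw : dot v w = 0.
  by rewrite dotBr dotZr divfK // dotC subrr.
have : [set x | dot u x = a] (x + w) by rewrite uv /= dotDr vw addr0.
rewrite /= dotDr ux -[RHS]addr0 => /addrI uw.
by rewrite -dotxx_eq0 {1}/w dotBl dotZl uw vw mulr0 subr0.
Qed.

Lemma enorm_sub_eq_addP (p q x : 'rV[R]_n) (d : R) : 0 <= d ->
  enorm (q - x) = enorm (p - x) + d <->
  2 * dot (q - p) (x - p) + 2 * d * enorm (p - x) = dot (q - p) (q - p) - d ^+ 2.
Proof.
move=> d0; rewrite (enormB p); set t := enorm (x - p).
have t2 : t ^+ 2 = dot (x - p) (x - p) by exact: sqr_enorm.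
have q2 : enorm (q - x) ^+ 2 =
    dot (q - p) (q - p) - 2 * dot (q - p) (x - p) + t ^+ 2.
  have -> : q - x = (q - p) - (x - p) by rewrite opprB addrA subrK.
  rewrite sqr_enorm t2; move: (q - p) (x - p) => u v.
  by rewrite dotBl !dotBr (dotC v u); ring.
split=> [e|e]; first by move: q2; rewrite e => q2; lra.
apply/eqP; rewrite -(@eqrXn2 _ 2) ?enorm_ge0 ?addr_ge0 ?enorm_ge0 //.
by apply/eqP; rewrite q2; lra.
Qed.

End DotProduct.

Section AffineIndependence.
Variables (R : realType) (n m : nat) (p : 'I_m -> 'rV[R]_n).
Hypothesis p_indep : affine_indep p.

(** Lowering the coefficient at [o] by the total of all coefficients makes them sum to zero and
    turns the relation between differences into one between the points. *)
Lemma affine_indep_sub (o : 'I_m) (c : 'I_m -> R) :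
  \sum_i c i *: (p i - p o) = 0 -> forall i, i != o -> c i = 0.
Proof.
move=> c0 i io; pose c' i := c i - (i == o)%:R * \sum_k c k.
suff /(_ i) : forall i, c' i = 0 by rewrite /c' (negPf io) mul0r subr0.
(* Stated for any module, as it serves for the scalars ([R^o]) and for the points. *)
have sum_o (V : lmodType R) (f : 'I_m -> V) : \sum_k (k == o)%:R *: f k = f o.
  rewrite (bigD1 o) //= eqxx scale1r big1 ?addr0 // => k /negPf ->.
  exact: scale0r.
apply: p_indep.
  rewrite sumrB -mulr_suml; have := sum_o R^o (fun=> 1).
  under eq_bigr do rewrite /GRing.scale /= mulr1.
  by move=> ->; rewrite mul1r subrr.
rewrite -[RHS]c0; under eq_bigr do rewrite scalerBl -scalerA.
under [RHS]eq_bigr do rewrite scalerBr.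
by rewrite !sumrB sum_o scaler_suml.
Qed.

(** [k] and [l] may coincide, so one lemma shows both that a normal is nonzero and that two normals
    are not proportional. *)
Lemma affine_indep_sub3 (o j k l : 'I_m) (a b c : R) :
    j != o -> k != j -> l != j ->
    a *: (p j - p o) + b *: (p k - p o) + c *: (p l - p o) = 0 ->
  a = 0.
Proof.
move=> jo kj lj e.
pose d i := a * (i == j)%:R + b * (i == k)%:R + c * (i == l)%:R.
suff : d j = 0.
  by rewrite /d eqxx !(eq_sym j) (negPf kj) (negPf lj) mulr1 !mulr0 !addr0.
apply: (affine_indep_sub (o := o)) => //; rewrite -[RHS]e.
have sum1 f z : \sum_i (z * (i == f)%:R) *: (p i - p o) = z *: (p f - p o).
  rewrite (bigD1 f) //= eqxx mulr1 big1 ?addr0 // => i /negPf ->.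
  by rewrite mulr0 scale0r.
by under eq_bigr do rewrite !scalerDl; rewrite !big_split /= !sum1.
Qed.

End AffineIndependence.

Lemma all_bisectors_ord0 (R : realType) (n m : nat) (p : 'I_m.+1 -> 'rV[R]_n)
    (r : 'I_m.+1 -> R) :
  all_bisectors p r =
    \bigcap_(j in [set j : 'I_m.+1 | (0 < j)%N]) bisector p r ord0 j.
Proof.
apply/seteqP; split=> x Bx.
  by move=> j /= j0; apply: (Bx (ord0, j)).
case=> j k /= jk; have B0k := Bx k (leq_ltn_trans (leq0n _) jk).
case: (posnP j) => [j0|/Bx B0j]; last by rewrite /bisector /= -B0j B0k.
by have -> : j = ord0 by apply: val_inj.
Qed.

(* s = m.+1 balls, indexed from 0: ord0 is the index i_1 and ord_max is i_s. *)
Theorem mainTheorem9 (R : realType) (n m : nat) (hm : (3 <= m.+1)%N)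
    (p : 'I_m.+1 -> 'rV[R]_n) (r : 'I_m.+1 -> R)
    (p_indep : affine_indep p)
    (r_ge0 : forall j, 0 <= r j)
    (r_sorted : forall j k : 'I_m.+1, (j <= k)%N -> r k <= r j)
    (r_first_last : r ord_max < r ord0)
    (r_dist : forall j k, j != k -> `|r j - r k| < enorm (p j - p k))
    (BS_nonempty : all_bisectors p r !=set0) :
  exists H : 'I_m.+1 -> set 'rV[R]_n,
    [/\ forall j : 'I_m.+1, (0 < j < m)%N -> hyperplane (H j),
        forall j k : 'I_m.+1,
          (0 < j < m)%N -> (0 < k < m)%N -> H j = H k -> j = k,
        forall j : 'I_m.+1, (0 < j < m)%N ->
          bisector p r ord0 ord_max `&` bisector p r ord0 j =
          bisector p r ord0 ord_max `&` H j,
        all_bisectors p r =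
          \bigcap_(j in [set j : 'I_m.+1 | (0 < j)%N]) bisector p r ord0 j
      & \bigcap_(j in [set j : 'I_m.+1 | (0 < j)%N]) bisector p r ord0 j =
          bisector p r ord0 ord_max `&`
          \bigcap_(j in [set j : 'I_m.+1 | (0 < j < m)%N]) H j].
Proof.
pose D j := r ord0 - r j; pose q j := p j - p ord0.
pose K j := dot (q j) (q j) - D j ^+ 2.
pose a j := D ord_max *: q j - D j *: q ord_max.
(* Eliminating the distance gives [2 * dot (a j) (x - p ord0)] on the left; halving and moving the
   base point from [p ord0] to the origin yields this constant. *)
pose b j := dot (a j) (p ord0) + (D ord_max * K j - D j * K ord_max) / 2.
pose H j : set 'rV[R]_n := [set x | dot (a j) x = b j].
have DM0 : D ord_max != 0 by rewrite subr_eq0 gt_eqF.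
have BE j x : bisector p r ord0 j x <->
    2 * dot (q j) (x - p ord0) + 2 * D j * enorm (p ord0 - x) = K j.
  have D_ge0 : 0 <= D j by rewrite subr_ge0 r_sorted.
  rewrite -enorm_sub_eq_addP // /bisector /D /=; split=> e; lra.
have HE j x : H j x <->
    D ord_max * (2 * dot (q j) (x - p ord0)) -
    D j * (2 * dot (q ord_max) (x - p ord0)) = D ord_max * K j - D j * K ord_max.
  rewrite /H /b /= /a; move: (q j) (q ord_max) => u v.
  by rewrite !dotBl !dotZl !dotBr; split=> e; lra.
have BH j x : bisector p r ord0 ord_max x -> bisector p r ord0 j x <-> H j x.
  (* Once [K ord_max] is replaced through [BM], the equation of [H j] is [D ord_max] times that of
     the bisector. *)
  move=> /BE BM; rewrite BE HE -BM; split=> [<-|e]; first by ring.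
  by apply: (mulfI DM0); lra.
have inner_neq0 (j : 'I_m.+1) : (0 < j < m)%N -> j != ord0.
  by case/andP=> j0 _; rewrite -val_eqE -lt0n.
have inner_neqmax (j : 'I_m.+1) : (0 < j < m)%N -> ord_max != j.
  by case/andP=> _ jm; rewrite -val_eqE /= gtn_eqF.
have m_gt0 : (0 < m)%N := ltnW (hm : (1 < m)%N).
have a_neq0 (j : 'I_m.+1) : (0 < j < m)%N -> a j != 0.
  move=> jm; apply/eqP => aj0; case/eqP: DM0.
  (* [a j = 0] is a relation in which [q j] has coefficient [D ord_max]; the third term is a
     dummy. *)
  apply: (affine_indep_sub3 p_indep (o := ord0) (j := j) (k := ord_max)
    (l := ord_max) (b := - D j) (c := 0)); rewrite ?inner_neq0 ?inner_neqmax //.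
  by rewrite scale0r addr0 scaleNr.
exists H; split.
- by move=> j jm; exists (a j), (b j); split=> //; exact: a_neq0.
(* Distinctness makes these really [m - 1], that is s - 2, hyperplanes. *)
- move=> j k jm km Hjk; apply/eqP/negPn/negP => jk.
  have H_neq0 : H j !=set0.
    case: BS_nonempty => x; rewrite all_bisectors_ord0 => Bx.
    by exists x; apply/BH; apply: Bx => //=; case/andP: jm.
  have [c ajk] := hyperplane_normal_collinear (a_neq0 k km) H_neq0 Hjk.
  (* Collecting [a j - c *: a k = 0] by [q j], [q k] and [q ord_max] gives these coefficients, with
     [D ord_max] at [q j]. *)
  case/eqP: DM0; apply: (affine_indep_sub3 p_indep (o := ord0) (j := j) (k := k)
    (l := ord_max) (b := - (c * D ord_max)) (c := c * D k - D j));
    rewrite ?inner_neq0 ?inner_neqmax // 1?eq_sym //.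
  move/eqP: ajk; rewrite -subr_eq0 => /eqP <-; rewrite /a /q.
  by apply/rowP => i; rewrite !mxE; ring.
- move=> j _; apply/seteqP; split=> x [BM].
    by move=> Bj; split=> //; apply/BH.
  by move=> Hj; split=> //; apply/BH.
- exact: all_bisectors_ord0.
- apply/seteqP; split=> x.
    move=> Bx; have BM : bisector p r ord0 ord_max x by exact: Bx.
    by split=> // j /= /andP[j0 _]; apply/BH => //; exact: Bx.
  (* A positive index is either the last, settled by [BM], or inner, where [H j] gives back the
     bisector. *)
  move=> [BM Hx] j /= j0; have := ltn_ord j; rewrite ltnS leq_eqVlt.
  case/orP => [/eqP jm|jm]; last by apply/BH => //; apply: Hx => /=; rewrite j0.
  by have -> : j = ord_max by apply: val_inj.
Qed.
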